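(* Let $X$ be an irreducible (affine) algebraic set over an algebraically closed field $k$, and let $R=\Gamma(X)$ be its coordinate ring. Then $R$ is unit-additive if and only if every nonconstant polynomial map $X\to k$ has a root (i.e. takes the value $0$ at some point of $X$).
   Context: All rings are commutative and unital. A ring $R$ is unit-additive if whenever $u,v$ are units of $R$, $u+v$ is either a unit of $R$ or a nilpotent element. An affine algebraic set is a Zariski-closed subset $X\subseteq k^n$; a polynomial map $X\to k$ is the restriction to $X$ of a polynomial function $k^n\to k$, and $\Gamma(X)$ is the ring of polynomial maps $X\to k$. *)

(* Defs.v *)
From HB Require Import structures.
From mathcomp Require Import all_boot all_order all_algebra.
From mathcomp Require Import boolp classical_sets functions.
From mathcomp.multinomials Require Import mpoly.

Set Implicit Arguments.
Unset Strict Implicit.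
Unset Printing Implicit Defensive.

Import GRing.Theory.
Local Open Scope classical_set_scope.
Local Open Scope ring_scope.

(* Stated over comPzRingType, so that the zero ring is allowed; [GRing.unit]
   is only available on nonzero rings with decidable units. *)
Section UnitAdditive.
Variable R : comPzRingType.

Definition is_unit (u : R) : Prop := exists v : R, u * v = 1.

Definition is_nilpotent (u : R) : Prop := exists m : nat, u ^+ m = 0.

Definition unit_additive : Prop :=
  forall u v : R, is_unit u -> is_unit v ->
    is_unit (u + v) \/ is_nilpotent (u + v).

End UnitAdditive.

Section AffineAlgebraicSets.
Variables (k : fieldType) (n : nat).

Definition zero_locus (S : set {mpoly k[n]}) : set ('I_n -> k) :=
  [set x | forall p, S p -> p.@[x] = 0].

Definition zariski_closed (X : set ('I_n -> k)) : Prop :=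
  exists S : set {mpoly k[n]}, X = zero_locus S.

(* For a closed X, the relatively closed subsets of X are exactly the closed
   subsets of k^n contained in X. *)
Definition irreducible_algebraic_set (X : set ('I_n -> k)) : Prop :=
  [/\ zariski_closed X, X !=set0 &
      forall A B : set ('I_n -> k), zariski_closed A -> zariski_closed B ->
        X = A `|` B -> X = A \/ X = B].

Definition is_polynomial_map (X : set ('I_n -> k)) (f : X -> k) : Prop :=
  exists p : {mpoly k[n]}, forall x : X, f x = p.@[val x].

Definition polynomial_map_pred (X : set ('I_n -> k)) : pred (X -> k) :=
  fun f => `[< is_polynomial_map f >].

Record coordinate_ring (X : set ('I_n -> k)) := PolynomialMap {
  polynomial_map_fun :> X -> k;
  _ : polynomial_map_fun \in @polynomial_map_pred X }.

End AffineAlgebraicSets.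

Section CoordinateRing.
Variables (k : fieldType) (n : nat) (X : set ('I_n -> k)).

HB.instance Definition _ := [isSub for @polynomial_map_fun k n X].
HB.instance Definition _ := [Choice of coordinate_ring X by <:].

Lemma polynomial_map_subring_closed : subring_closed (@polynomial_map_pred k n X).
Proof.
split.
- by apply/asboolP; exists 1 => x; rewrite meval1.
- move=> f g /asboolP[p fp] /asboolP[q gq]; apply/asboolP; exists (p - q) => x.
  by rewrite mevalB -fp -gq.
- move=> f g /asboolP[p fp] /asboolP[q gq]; apply/asboolP; exists (p * q) => x.
  by rewrite mevalM -fp -gq.
Qed.

(* Pointwise operations, inherited from the ring of all functions X -> k. *)
HB.instance Definition _ :=
  GRing.SubChoice_isSubComPzRing.Build (X -> k) (@polynomial_map_pred k n X)
    (coordinate_ring X) polynomial_map_subring_closed.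

End CoordinateRing.

(* Main.v *)
(** If f vanishes nowhere on X, the weak Nullstellensatz makes f a unit of
    Gamma(X), so unit-additivity makes f - f(x0) a unit or nilpotent. It vanishes
    at x0, hence is nilpotent, hence zero, and f is constant. Conversely, if all
    nonconstant maps have roots, then the units are the nonzero constants.

    The weak Nullstellensatz is reduced by Zorn's lemma to a prime ideal Q of
    k[x_1, ..., x_n]. Induction on n shows that for every f outside Q some zero
    of Q is not a zero of f. In the step, Q is seen as a prime ideal of A[T],
    and one finds e in A outside Q such that every zero of the contraction of Q
    to A where e does not vanish extends to a zero of Q where f does not vanish. *)

From HB Require Import structures.
Require Import Defs.
From mathcomp Require Import all_boot all_order all_algebra ring_quotient zify.
From mathcomp Require Import boolp classical_sets functions.
From mathcomp.multinomials Require Import mpoly.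

Import GRing.Theory.
Local Open Scope classical_set_scope.
Local Open Scope ring_scope.

(** * Contraction of prime ideals, and primes above a proper ideal *)

Section PrimeIdeals.
Set Implicit Arguments.
Unset Strict Implicit.

Definition ideal_comap (R S : nzRingType) (f : R -> S) (Q : {pred S}) : {pred R} :=
  fun x => f x \in Q.

Section Comap.
Variables (R S : comNzRingType) (f : {rmorphism R -> S}) (Q : prime_idealr S).

Lemma ideal_comapE x : (x \in ideal_comap f Q) = (f x \in (Q : pred S)).
Proof. by []. Qed.

Lemma ideal_comap_closed : idealr_closed (ideal_comap f Q).
Proof.
split; rewrite ?ideal_comapE ?rmorph0 ?rmorph1 ?idealr0 ?idealr1 //.
by move=> a u v; rewrite !ideal_comapE rmorphD rmorphM => uQ vQ;
  rewrite rpredD ?idealMr.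
Qed.

Lemma ideal_comap_prime : prime_idealr_closed (ideal_comap f Q).
Proof. by move=> u v; rewrite !ideal_comapE rmorphM prime_idealrM. Qed.

HB.instance Definition _ := isIdealr.Build R (ideal_comap f Q) ideal_comap_closed.
HB.instance Definition _ :=
  isPrimeIdealrClosed.Build R (ideal_comap f Q) ideal_comap_prime.

End Comap.

Lemma prime_idealrX (R : comNzRingType) (Q : prime_idealr R) (x : R) m :
  x \notin (Q : pred R) -> x ^+ m \notin (Q : pred R).
Proof.
move=> xQ; elim: m => [|m IHm]; first by rewrite expr0 idealr1.
by rewrite exprS prime_idealrM negb_or xQ.
Qed.

(** An ideal [Q0] maximal among the proper ideals containing [J] is prime: for [u] outside it, (u) +
    [Q0] contains 1, and multiplying 1 = a u + b by [v] puts [v] in [Q0] as soon as u v is there. *)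
Lemma prime_ideal_above (R : comNzRingType) (J : {pred R}) :
  idealr_closed J -> exists Q : prime_idealr R, {subset J <= (Q : pred R)}.
Proof.
move=> [J0 J1 JM].
(* Zorn is applied to B with J :|: B a proper ideal, so that the empty chain is bounded. *)
pose JU (B : set R) := [set` J] `|` B.
pose pr (B : set R) : {pred R} := fun x => `[< B x >].
have prE B x : (x \in pr B) = B x :> Prop by rewrite /in_mem /= asboolE.
have JUJ B : [set` J] `<=` B -> JU B = B by move=> JB; rewrite /JU setUidPr.
have [F FP Ftot|B [Q0closed Bmax]] :=
    @Zorn_bigcup R [set B | idealr_closed (pr (JU B))].
  have subJU B x : F B -> JU B x -> JU (\bigcup_(X in F) X) x.
    by move=> FB [Jx|Bx]; [left|right; exists B].
  have sumJU B a u v : F B -> JU B u -> JU B v -> JU (\bigcup_(X in F) X) (a * u + v).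
    move=> FB Bu Bv; apply: (subJU B) => //.
    by have [_ _ /(_ a u v)] := FP _ FB; rewrite !prE; apply.
  split; first by rewrite prE; left.
    apply/negP; rewrite prE => -[|[B FB B1]]; first exact/negP.
    by have [_ /negP + _] := FP _ FB; rewrite prE; apply; right.
  move=> a u v; rewrite !prE => -[Ju|[B FB Bu]] [Jv|[C FC Cv]].
  - by left; apply: JM.
  - by apply: (sumJU C) => //; [left|right].
  - by apply: (sumJU B) => //; [right|left].
  - have [BC|CB] := Ftot _ _ FB FC.
      by apply: (sumJU C) => //; right => //; exact: BC.
    by apply: (sumJU B) => //; right => //; exact: CB.
pose Q0 := pr (JU B); move: Q0closed => /= Q0closed.
have [B0 B1 BM] : idealr_closed Q0 by [].
have Q0prime : prime_idealr_closed Q0.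
  move=> u v uvQ; case: (boolP (u \in Q0)) => //= uQ.
  pose C : set R := [set x | exists a b, b \in Q0 /\ x = a * u + b].
  have QC : JU B `<=` C by move=> x Bx; exists 0, x; rewrite mul0r add0r prE.
  have JC : JU C = C by apply: JUJ => x Jx; apply: QC; left.
  have uC : C u by exists 1, 0; rewrite mul1r addr0.
  have BC : B `<` C.
    split; first by move=> x Bx; apply: QC; right.
    by move=> CB; move/negP: uQ; apply; rewrite prE; right; apply: CB.
  case: (pselect (C 1)) => [[a [b [bQ e1]]]|C1].
    rewrite -[v]mul1r e1 mulrDl -mulrA; apply: (BM) => //.
    by rewrite mulrC -[_ * _]addr0; apply: BM.
  case: (Bmax C BC); rewrite /= JC; split.
  - by rewrite prE; apply: QC; rewrite prE in B0.
  - by apply/negP; rewrite prE.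
  move=> c x y; rewrite !prE => -[a [b [bQ ->]]] [a' [b' [bQ' ->]]].
  exists (c * a + a'), (c * b + b'); split; first exact: BM.
  by rewrite mulrDr mulrDl !mulrA addrACA.
pose Qi := isIdealr.Build R Q0 Q0closed.
pose Qp := isPrimeIdealrClosed.Build R Q0 Q0prime.
pose Q : prime_idealr R := HB.pack Q0 Qi Qp.
by exists Q => x Jx; rewrite prE; left.
Qed.

End PrimeIdeals.

(** * Extending zeros from A to A[T] *)

Section Extension.
Set Implicit Arguments.
Unset Strict Implicit.
Variables (A : idomainType) (Q : prime_idealr {poly A}).

Let I : prime_idealr A := ideal_comap polyC Q.
(** The extension to A[T] of the contraction [I] of [Q]. It lies in [Q], and every morphism killing
    [I] sends it to the zero polynomial. *)
Let O : {pred {poly A}} := polyOver I.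

Let memI a : (a \in (I : pred A)) = (a%:P \in (Q : pred {poly A})).
Proof. by []. Qed.

Let OP (p : {poly A}) : reflect (forall i, p`_i \in (I : pred A)) (p \in O).
Proof. exact: polyOverP. Qed.

Let O_sub_Q (p : {poly A}) : p \in O -> p \in (Q : pred {poly A}).
Proof.
move=> /OP pO; rewrite -[p]coefK poly_def rpred_sum // => i _.
by rewrite -mul_polyC mulrC idealMr // -memI.
Qed.

Let O_mull (p q : {poly A}) : q \in O -> p * q \in O.
Proof.
by move=> /OP qO; apply/OP => i; rewrite coefM rpred_sum // => j _; rewrite idealMr.
Qed.

Let O_add (p q : {poly A}) : p \in O -> q \in O -> p + q \in O.
Proof. by move=> /OP pO /OP qO; apply/OP => i; rewrite coefD rpredD. Qed.

(* If the leading coefficient were in I, dropping the leading term would give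
   a smaller element of S outside O. *)
Let minimal_elt (S : {poly A} -> Prop) :
  (forall p q, S p -> q \in O -> S (p - q)) -> (exists2 p, S p & p \notin O) ->
  exists g, [/\ S g, lead_coef g \notin (I : pred A) &
    forall p, S p -> (size p < size g)%N -> p \in O].
Proof.
move=> SB exS.
pose T m := `[< exists p, [/\ S p, p \notin O & size p = m] >].
have exT : exists m, T m.
  by have [p Sp pO] := exS; exists (size p); apply/asboolP; exists p.
case: (ex_minnP exT) => m /asboolP[g [Sg gO gm]] min; exists g.
have gmin p : S p -> (size p < size g)%N -> p \in O.
  move=> Sp; rewrite gm ltnNge; apply: contraNT => pO.
  by apply: min; apply/asboolP; exists p.
split => //; apply/negP => lgI.
have g0 : g != 0 by apply: contraNneq gO => ->; apply/OP => i; rewrite coef0 idealr0.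
pose h := lead_coef g *: 'X^((size g).-1).
have hO : h \in O.
  by apply/OP => i; rewrite coefZ mulrC idealMr.
have gh : (size (g - h)%R < size g)%N.
  rewrite [X in (_ < X)%N](polySpred g0) ltnS; apply/leq_sizeP => j; rewrite leq_eqVlt.
  rewrite coefB coefZ coefXn => /predU1P[<-|lt_gj]; first by rewrite eqxx mulr1 subrr.
  rewrite gtn_eqF // mulr0 subr0 nth_default //.
  by rewrite (polySpred g0).
by move/negP: gO; apply; rewrite -[g](subrK h) O_add // gmin //; apply: SB.
Qed.

Let pseudo_division (p d : {poly A}) : d != 0 ->
  exists m q r, (lead_coef d ^+ m)%:P * p = q * d + r /\ (size r < size d)%N.
Proof.
move=> d0; exists (Pdiv.Ring.rscalp p d), (Pdiv.Ring.rdivp p d), (Pdiv.Ring.rmodp p d).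
by rewrite mul_polyC Pdiv.ComRing.rdivp_eq Pdiv.Ring.ltn_rmodp.
Qed.

(** Allows the factor introduced by pseudo-division to be cancelled modulo the prime [Q]. *)
Let lead_power (g : {poly A}) m :
  lead_coef g \notin (I : pred A) -> (lead_coef g ^+ m)%:P \notin (Q : pred {poly A}).
Proof. by move=> lg; rewrite -memI prime_idealrX. Qed.

Let lead_neq0 (g : {poly A}) : lead_coef g \notin (I : pred A) -> g != 0.
Proof. by apply: contraNneq => ->; rewrite lead_coef0 idealr0. Qed.

Let lead_notinO (g : {poly A}) : lead_coef g \notin (I : pred A) -> g \notin O.
Proof. by apply: contra => /OP; apply. Qed.

(* In the second case s is the element of minimal degree outside O of the ideal
   (f) + Q: were its degree positive, pseudo-division of g by it would give a
   quotient in Q of degree below that of g. *)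
Let constant_multiple (f : {poly A}) : f \notin (Q : pred {poly A}) ->
  {in (Q : pred {poly A}), forall q, q \in O} \/
  exists g s, [/\ g \in (Q : pred {poly A}), lead_coef g \notin (I : pred A),
    forall p, p \in (Q : pred {poly A}) -> (size p < size g)%N -> p \in O &
    s \notin (I : pred A) /\
    exists u v, v \in (Q : pred {poly A}) /\ s%:P = u * f + v].
Proof.
move=> fQ.
case: (pselect (exists2 q, q \in (Q : pred {poly A}) & q \notin O)); last first.
  move=> nQ; left => q qQ; apply: contrapT => /negP qO; apply: nQ; by exists q.
move=> exQ; right.
have [|g [gQ lg gmin]] := minimal_elt _ exQ.
  by move=> p q pQ /O_sub_Q qQ; rewrite rpredB.
pose S p := exists u v, v \in (Q : pred {poly A}) /\ p = u * f + v.
have SB a b p q : S p -> S q -> S (a * p + b * q).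
  move=> [u [v [vQ ->]]] [u' [v' [vQ' ->]]].
  exists (a * u + b * u'), (a * v + b * v'); split; first by rewrite rpredD ?idealMr.
  by rewrite !mulrDr mulrDl !mulrA addrACA.
have QS q : q \in (Q : pred {poly A}) -> S q.
  by move=> qQ; exists 0, q; rewrite mul0r add0r.
have Sf : S f by exists 1, 0; rewrite mul1r addr0 idealr0.
have [||m [Sm lm mmin]] := @minimal_elt S.
- move=> p q Sp /O_sub_Q/QS Sq; rewrite -[p]mul1r -mulN1r; exact: SB.
- by exists f => //; apply: contra fQ => /O_sub_Q.
exists g, (lead_coef m); split => //; split => //.
suff /size1_polyC em : (size m <= 1)%N.
  by move: Sm; rewrite {1}em (_ : m`_0 = lead_coef m) // em lead_coefC coefC.
rewrite leqNgt; apply/negP => m_gt1.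
have m0 := lead_neq0 lm.
have rO p : S p -> exists N q r, [/\ (lead_coef m ^+ N)%:P * p = q * m + r,
    r \in O & (size r < size m)%N].
  move=> Sp; have [N [q [r [e ltr]]]] := pseudo_division p m0.
  exists N, q, r; split => //; apply: mmin => //.
  have -> : r = (lead_coef m ^+ N)%:P * p + (- q) * m.
    by rewrite e mulNr addrC addKr.
  exact: SB.
(* Otherwise a pseudo-division of [f] by [m] would put a multiple of [f] by a power of the leading
   coefficient, hence [f] itself, in [Q]. *)
have mQ : m \notin (Q : pred {poly A}).
  apply/negP => mQ; have [N [q [r [e /O_sub_Q rQ _]]]] := rO _ Sf.
  have : (lead_coef m ^+ N)%:P * f \in (Q : pred {poly A}).
    by rewrite e rpredD ?idealMr.
  by rewrite prime_idealrM (negPf fQ) orbF (negPf (lead_power N lm)).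
have [N [q [r [e rO' ltr]]]] := rO _ (QS _ gQ).
have qQ : q \in (Q : pred {poly A}).
  have : q * m \in (Q : pred {poly A}).
    have -> : q * m = (lead_coef m ^+ N)%:P * g - r by rewrite e addrK.
    by rewrite rpredB ?idealMr // O_sub_Q.
  by rewrite prime_idealrM (negPf mQ) orbF.
(* For nonzero [q], the product [q * m] has larger degree than [q] because [m] is nonconstant, and
   [r] is too small to cancel its leading term. *)
have q_lt_g : (size q < size g)%N.
  have [->|q0] := eqVneq q 0; first by rewrite size_poly0 size_poly_gt0 lead_neq0.
  have sqm : size (q * m) = (size q + size m).-1 by rewrite size_mul.
  have q_gt0 : (0 < size q)%N by rewrite size_poly_gt0.
  have sg : (size (q * m + r)%R <= size g)%N by rewrite -e mul_polyC size_scale_leq.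
  rewrite size_polyDl ?sqm in sg; lia.
(* By minimality of [g], [q] lies in [O]; then so does the whole right side, and primality forces
   the leading coefficient of [g] into [I]. *)
have gO : (lead_coef m ^+ N)%:P * g \in O.
  by rewrite e O_add // mulrC O_mull // gmin.
have /OP/(_ (size g).-1) := gO; rewrite coefCM prime_idealrM.
by rewrite (negPf (prime_idealrX N lm)) /= -lead_coefE (negPf lg).
Qed.

(** If [Q] is the extension of [I], a coefficient of [f] outside [I] serves as [e], and any nonroot
    of the image of [f] as [t]. Otherwise [e] is [lead_coef g * s]: the first factor keeps the
    degree of [g], whose image then has a root [t], and lets pseudo-division by [g] show that all of
    [Q] vanishes at [t]; the second, being u f + v with v in [Q], keeps [f] nonzero there. *)
Lemma prime_ideal_point_extension (f : {poly A}) : f \notin (Q : pred {poly A}) ->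
  exists2 e : A, e%:P \notin (Q : pred {poly A}) &
  forall (k : closedFieldType) (psi : {rmorphism A -> k}),
    (forall a, a%:P \in (Q : pred {poly A}) -> psi a = 0) -> psi e != 0 ->
  exists2 t, forall q, q \in (Q : pred {poly A}) -> (map_poly psi q).[t] = 0 &
    (map_poly psi f).[t] != 0.
Proof.
move=> fQ.
have mapO (k : closedFieldType) (psi : {rmorphism A -> k}) :
    (forall a, a%:P \in (Q : pred {poly A}) -> psi a = 0) ->
    forall q, q \in O -> map_poly psi q = 0.
  by move=> psiQ q /OP qO; apply/polyP => i; rewrite coef_map coef0; apply: psiQ; rewrite -memI.
have [QO|] := constant_multiple fQ.
  have /OP fO : f \notin O by apply: contra fQ => /O_sub_Q.
  have [i fi] : exists i, f`_i \notin (I : pred A).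
    by apply: contrapT => nf; apply: fO => i; apply: contrapT => fi;
      apply: nf; exists i; apply/negP.
  exists f`_i => // k psi psiQ psi_fi.
  have /closed_nonrootP[t ft] : map_poly psi f != 0.
    by apply: contraNneq psi_fi => f0; rewrite -coef_map f0 coef0.
  by exists t => // q /QO/(mapO _ _ psiQ)->; rewrite horner0.
move=> [g [s [gQ lg gmin [sI [u [v [vQ es]]]]]]].
exists (lead_coef g * s); first by rewrite -memI prime_idealrM negb_or lg.
move=> k psi psiQ; rewrite rmorphM mulf_eq0 negb_or => /andP[psi_lg psi_s].
(* The image of [g] has the size of [g], and [g] is not constant since its leading coefficient would
   then lie in [I]. *)
have /closed_rootP[t /eqP gt] : size (map_poly psi g) != 1.
  rewrite size_map_poly_id0 //; apply/negP => /eqP/eqP/size_poly1P[c c0 eg].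
  by move/negP: lg; apply; rewrite eg lead_coefC memI -eg.
have Qt q : q \in (Q : pred {poly A}) -> (map_poly psi q).[t] = 0.
  move=> qQ; have [N [d [r [e ltr]]]] := pseudo_division q (lead_neq0 lg).
  have rO : r \in O.
    apply: gmin => //; have -> : r = (lead_coef g ^+ N)%:P * q - d * g.
      by rewrite e addrC addKr.
    by rewrite rpredB ?idealMr.
  have /(congr1 (fun p => (map_poly psi p).[t])) := e.
  rewrite !rmorphD !rmorphM /= map_polyC hornerD !hornerM hornerC gt mulr0 add0r.
  have lgN : psi (lead_coef g ^+ N) != 0 by rewrite rmorphXn expf_neq0.
  rewrite (mapO _ _ psiQ r rO) horner0 => /eqP; rewrite mulf_eq0.
  by rewrite (negPf lgN) => /eqP.
exists t => //; apply: contraNneq psi_s => ft.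
have /(congr1 (fun p => (map_poly psi p).[t])) := es.
by rewrite rmorphD rmorphM /= map_polyC hornerD hornerM hornerC ft mulr0 Qt // addr0 => ->.
Qed.

End Extension.

(** * The weak Nullstellensatz by induction on the number of variables *)

Section Nullstellensatz.
Set Implicit Arguments.
Unset Strict Implicit.

(** Substitutes the last variable for T. As a ring morphism with right inverse [muni], it turns
    primes of the polynomial ring in n+1 variables into primes of A[T]. *)
Definition mpoly_of_poly (R : comNzRingType) n : {poly {mpoly R[n]}} -> {mpoly R[n.+1]} :=
  horner_eval 'X_ord_max \o map_poly (@mwiden n R).

HB.instance Definition _ (R : comNzRingType) n :=
  GRing.RMorphism.on (@mpoly_of_poly R n).

Lemma meval_mwiden (R : comNzRingType) n (a : 'I_n.+1 -> R) (p : {mpoly R[n]}) :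
  (mwiden p).@[a] = p.@[fun i => a (widen_ord (leqnSn n) i)].
Proof.
elim/mpolyind: p => [|c m p _ _ IHp]; first by rewrite mwiden0 !meval0.
rewrite mwidenD mwidenZ mwidenX !mevalD !mevalZ !mevalX IHp; congr (_ * _ + _).
rewrite big_ord_recr /= mnmwiden_ordmax expr0 mulr1.
by apply: eq_bigr => i _; rewrite mnmwiden_widen.
Qed.

Lemma meval_mpoly_of_poly (R : comNzRingType) n (a : 'I_n.+1 -> R)
    (q : {poly {mpoly R[n]}}) :
  (mpoly_of_poly q).@[a]
    = (map_poly (meval (fun i => a (widen_ord (leqnSn n) i))) q).[a ord_max].
Proof.
rewrite /mpoly_of_poly /= horner_evalE -horner_map -map_poly_comp /= mevalXU.
by congr (_.[_]); apply: eq_map_poly => p; rewrite /= meval_mwiden.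
Qed.

Lemma muniK (R : comNzRingType) n : cancel (@muni n R) (@mpoly_of_poly R n).
Proof.
move=> p; rewrite muniE rmorph_sum /= [RHS]mpolyE; apply: eq_bigr => m _.
rewrite /mpoly_of_poly /= horner_evalE !linearZ /= map_polyXn /= -!mul_polyC.
rewrite hornerM hornerC hornerXn mwidenZ mwidenX -scalerAl mpolyXn -mpolyXD.
congr (_ *: 'X_[_]); apply/mnmP => i; rewrite mnmDE mulmnE mnm1E.
have [->|i_max] := eqVneq i ord_max; first by rewrite mnmwiden_ordmax mul1n.
have lt_in : (i < n)%N by rewrite ltn_neqAle -ltnS ltn_ord andbT.
have -> : i = widen_ord (leqnSn n) (Ordinal lt_in) by apply: val_inj.
by rewrite mnmwiden_widen mnmE mul0n addn0.
Qed.

Lemma prime_ideal_point (k : closedFieldType) n (Q : prime_idealr {mpoly k[n]}) f :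
  f \notin (Q : pred {mpoly k[n]}) ->
  exists2 a : 'I_n -> k, forall p, p \in (Q : pred {mpoly k[n]}) -> p.@[a] = 0 &
    f.@[a] != 0.
Proof.
elim: n => [|n IHn] in Q f *.
  (* Without variables every polynomial is constant, so a nonzero element of [Q] would be
     invertible. *)
  have constE (p : {mpoly k[0]}) : p = (p.@[fun=> 0])%:MP.
    elim/mpolyind: p => [|c m p _ _ {1}->]; first by rewrite meval0 mpolyC0.
    rewrite mevalD mevalZ mevalX big_ord0 mulr1 mpolyCD; congr (_ + _).
    have -> : m = 0%MM by apply/mnmP => -[].
    by rewrite mpolyX0 alg_mpolyC.
  move=> fQ; exists (fun=> 0) => [p pQ|].
    apply/eqP/negPn/negP => p0; have := idealr1 Q.
    rewrite -(mpolyC1 0 k) -(mulVf p0) mpolyCM.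
    by rewrite -constE idealMr.
  by apply: contraNneq fQ => f0; rewrite (constE f) f0 mpolyC0 idealr0.
rewrite -[f]muniK => fQ.
have [|e eQ ext] := @prime_ideal_point_extension _ (ideal_comap (@mpoly_of_poly k n) Q) (muni f).
  exact: fQ.
have [a aQ ae] := IHn (ideal_comap polyC (ideal_comap (@mpoly_of_poly k n) Q)) e eQ.
have [t tQ tf] := ext k (meval a) aQ ae.
(* The point [a] with [t] appended: [insub] fails exactly at the last index. *)
pose b (i : 'I_n.+1) := if insub (i : nat) is Some j then a j else t.
have ba : (fun i => b (widen_ord (leqnSn n) i)) = a.
  by apply/funext => i; rewrite /b /= valK.
have bt : b ord_max = t by rewrite /b insubF //= ltnn.
exists b => [p|]; last by rewrite meval_mpoly_of_poly ba bt.
by rewrite -[p]muniK => pQ; rewrite meval_mpoly_of_poly ba bt; apply: tQ.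
Qed.

Lemma weak_nullstellensatz (k : closedFieldType) n (J : {pred {mpoly k[n]}}) :
  idealr_closed J -> exists a : 'I_n -> k, forall p, p \in J -> p.@[a] = 0.
Proof.
move=> /prime_ideal_above[Q JQ].
have [|a aQ _] := @prime_ideal_point k n Q 1; first by rewrite idealr1.
by exists a => p /JQ; exact: aQ.
Qed.

End Nullstellensatz.

(** * Units of the coordinate ring *)

Section CoordinateRingUnits.
Set Implicit Arguments.
Unset Strict Implicit.
Variables (k : closedFieldType) (n : nat) (X : set ('I_n -> k)).

Definition coordinate_ring_of_mpoly (p : {mpoly k[n]}) : coordinate_ring X :=
  PolynomialMap (introT (asboolP _) (ex_intro _ p (fun x => erefl p.@[val x]))
    : (fun x : X => p.@[val x]) \in polynomial_map_pred (X := X)).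

Lemma coordinate_ringP (f g : coordinate_ring X) : (forall x, f x = g x) <-> f = g.
Proof. by split=> [fg|->//]; apply: val_inj; apply/funext. Qed.

(** For [p] representing a nowhere vanishing [f], a common zero of the ideal [J] generated by [p]
    and the polynomials vanishing on [X] would lie in [X], as [X] is closed, and be a root of [f].
    So [J] contains 1 = a p + b, and [a] restricts to the inverse of [f]. *)
Lemma is_unit_coordinate_ring (f : coordinate_ring X) : zariski_closed X ->
  is_unit f <-> forall x : X, f x != 0.
Proof.
move=> [S XS]; split=> [[g fg] x|f0].
  have /coordinate_ringP/(_ x) fgx := fg.
  apply/eqP => fx0; have : f x * g x = 1 by exact: fgx.
  by rewrite fx0 mul0r => /esym/eqP; rewrite oner_eq0.
have /asboolP[p fp] := valP f.
pose vanish (q : {mpoly k[n]}) := forall x, X x -> q.@[x] = 0.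
pose J : {pred {mpoly k[n]}} :=
  fun q => `[< exists a b, vanish b /\ q = a * p + b >].
have JE q : (q \in J) = (exists a b, vanish b /\ q = a * p + b) :> Prop.
  by rewrite /in_mem /= asboolE.
case: (pselect (1 \in J)) => [|J1].
  rewrite JE => -[a [b [bX e1]]].
  exists (coordinate_ring_of_mpoly a); apply/coordinate_ringP => x.
  change (f x * a.@[val x] = 1).
  rewrite fp mulrC -mevalM -[LHS]addr0 -(bX (val x) (set_valP x)) -mevalD -e1.
  exact: meval1.
have [|a aJ] := @weak_nullstellensatz k n J.
  split; first by rewrite JE; exists 0, 0; split; rewrite ?mul0r ?addr0 // => x _;
    rewrite meval0.
    exact/negP.
  move=> c q r; rewrite !JE => -[u [v [vX ->]]] [u' [v' [vX' ->]]].
  exists (c * u + u'), (c * v + v'); split.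
    by move=> x Xx; rewrite mevalD mevalM vX // vX' // mulr0 addr0.
  by rewrite mulrDr mulrDl !mulrA addrACA.
have Xa : X a.
  rewrite XS => q Sq; apply: aJ; rewrite JE; exists 0, q; rewrite mul0r add0r; split=> //.
  by move=> x; rewrite XS; apply.
have /eqP[] := f0 (SigSub (mem_set Xa)); rewrite fp /=; apply: aJ; rewrite JE.
by exists 1, 0; rewrite mul1r addr0; split=> // x _; rewrite meval0.
Qed.

End CoordinateRingUnits.

(** * Unit-additivity and roots of nonconstant polynomial maps *)

Theorem mainTheorem5 (k : closedFieldType) (n : nat) (X : set ('I_n -> k))
  (hX : irreducible_algebraic_set X) :
  unit_additive (coordinate_ring X) <->
  (forall f : coordinate_ring X, ~ (exists c : k, forall x : X, f x = c) ->
     exists x : X, f x = 0).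
Proof.
have [Xclosed [x0 Xx0] _] := hX.
pose y0 : X := SigSub (mem_set Xx0).
have unitE f := is_unit_coordinate_ring f Xclosed.
pose cst c : coordinate_ring X := coordinate_ring_of_mpoly X c%:MP.
have cstE c x : cst c x = c by exact: mevalC.
split=> [UA f fconst|roots u v].
  apply: contrapT => nroot.
  have f0 x : f x != 0 by apply/eqP => fx0; apply: nroot; exists x.
  have uf : is_unit f by apply/unitE.
  (* The base value of [f] is nonzero, so its negative is a constant unit; adding it makes [f]
     vanish at [y0], which rules out the unit case below. *)
  have uc : is_unit (cst (- f y0)) by apply/unitE => x; rewrite cstE oppr_eq0.
  have fcE x : (f + cst (- f y0)) x = f x - f y0.
    by change (f x + cst (- f y0) x = f x - f y0); rewrite cstE.
  have [/unitE/(_ y0)|[m fm]] := UA _ _ uf uc; first by rewrite fcE subrr eqxx.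
  apply: fconst; exists (f y0) => x; apply/eqP; rewrite -subr_eq0 -fcE.
  have powE (g : coordinate_ring X) j : (g ^+ j) x = g x ^+ j.
    elim: j => [|j IHj]; first by rewrite !expr0.
    by rewrite !exprS -IHj.
  have /coordinate_ringP/(_ x) := fm; rewrite powE => /eqP.
  by rewrite expf_eq0 => /andP[].
have const f : is_unit f -> exists2 c, c != 0 & f = cst c.
  move=> /unitE f0; have [c fc] : exists c : k, forall x, f x = c.
    by apply: contrapT => /roots[x fx0]; have := f0 x; rewrite fx0 eqxx.
  exists c; first by rewrite -(fc y0).
  by apply/coordinate_ringP => x; rewrite fc cstE.
move=> /const[c _ ->] /const[d _ ->].
have cdE x : (cst c + cst d) x = c + d.
  by change (cst c x + cst d x = c + d); rewrite !cstE.
(* A sum of two constants is either a nonzero constant, hence a unit, or 0, nilpotent with exponent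
   1. *)
have [cd0|cd0] := eqVneq (c + d) 0.
  by right; exists 1%N; rewrite expr1; apply/coordinate_ringP => x; rewrite cdE cd0.
by left; apply/unitE => x; rewrite cdE.
Qed.
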